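(* Let $a_1,b_1,a_2,b_2,a_3,b_3$ be real numbers with $0\le a_i<b_i$ for $i=1,2,3$ and $$a_1b_2b_3+b_1a_2a_3 \;\le\; b_1a_2b_3+a_1b_2a_3 \;\le\; b_1b_2a_3+a_1a_2b_3 .$$ Let $\mathcal{P}_H\subset\mathbb{R}^4$ be the trilinear hull, i.e. the convex hull of the eight points $(x_1x_2x_3,\,x_1,\,x_2,\,x_3)$ with $x_i\in\{a_i,b_i\}$ for $i=1,2,3$. Then the 4-dimensional volume of $\mathcal{P}_H$ is $$\operatorname{Vol}(\mathcal{P}_H)=\frac{(b_1-a_1)(b_2-a_2)(b_3-a_3)\Big(b_1(5b_2b_3-a_2b_3-b_2a_3-3a_2a_3)+a_1(5a_2a_3-b_2a_3-a_2b_3-3b_2b_3)\Big)}{24}.$$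
   Context: Points of $\mathbb{R}^4$ are written with coordinates $(f,x_1,x_2,x_3)$. The polytope $\mathcal{P}_H$ is the convex hull of the graph of $f=x_1x_2x_3$ over the box $[a_1,b_1]\times[a_2,b_2]\times[a_3,b_3]$; its extreme points are the eight points $(x_1x_2x_3,x_1,x_2,x_3)$ with each $x_i\in\{a_i,b_i\}$. $\operatorname{Vol}$ denotes 4-dimensional Lebesgue measure. *)

(* Defs.v *)
From mathcomp Require Import all_boot all_order all_algebra.
From mathcomp Require Import all_classical all_reals all_analysis.

Set Implicit Arguments.
Unset Strict Implicit.
Unset Printing Implicit Defensive.

Import Order.TTheory GRing.Theory Num.Theory.
Import numFieldNormedType.Exports.

Local Open Scope classical_set_scope.
Local Open Scope ring_scope.

Definition convex_hull (R : numDomainType) (M : lmodType R) (S : set M) : set M :=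
  smallest (@convex_set R M) S.

(* Points of R^4, nested as (((f, x1), x2), x3); the alias R^o provides the
   R-module structure that the notion of convexity needs. *)
Definition R4 (R : realType) : lmodType R := (R^o * R^o * R^o * R^o)%type.

(* The extreme points of the trilinear hull: the points of the graph of
   f = x1 x2 x3 over the vertices of the box. *)
Definition trilinear_vertices (R : realType) (a1 b1 a2 b2 a3 b3 : R) :
    set (R4 R) :=
  [set p | exists x1 x2 x3 : R,
    [/\ [set a1; b1] x1, [set a2; b2] x2, [set a3; b3] x3 &
        p = (x1 * x2 * x3, x1, x2, x3)]].

Definition trilinear_hull (R : realType) (a1 b1 a2 b2 a3 b3 : R) : set (R4 R) :=
  convex_hull (trilinear_vertices a1 b1 a2 b2 a3 b3).

(* Four-dimensional Lebesgue measure on the Borel sets, as the product of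
   four copies of the one-dimensional one. *)
Definition Vol (R : realType) :
    {measure set (measurableTypeR R * measurableTypeR R * measurableTypeR R *
                  measurableTypeR R)%type -> \bar R} :=
  (((@lebesgue_measure R \x @lebesgue_measure R) \x @lebesgue_measure R)
    \x @lebesgue_measure R)%E.

(* Main.v *)
(* With t_i = (x_i - a_i) / (b_i - a_i), encode a convex combination of the vertices,
   with weights w_S for S a subset of {1, 2, 3}, by t_i = the sum of the w_S with i in
   S and, likewise, p_ij and p_123; Moebius inversion recovers the weights. The first
   coordinate is affine in (t, p), the coefficients c_12, c_13, c_23, c_123 of p being
   nonnegative. For fixed t it is largest when p_ij = min(t_i, t_j) and p_123 =
   min(t_1, t_2, t_3). The hypotheses say that c_23 <= c_13 <= c_12, so that its p-part
   is a nonnegative combination of p_12, p_13, p_12 + p_13 + p_23 and p_123, which attain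
   their least values simultaneously. Hence the hull is the region between two explicit
   piecewise linear graphs over the box, and its volume is an iterated integral of
   t^n and max(0, t + c)^n. *)

From HB Require Import structures.
Require Import Defs.
From mathcomp Require Import all_boot all_order all_algebra.
From mathcomp Require Import all_classical all_reals all_analysis.
From mathcomp Require Import measurable_realfun.
From mathcomp Require Import ring lra.

Set Implicit Arguments.
Unset Strict Implicit.
Unset Printing Implicit Defensive.

Import Order.TTheory GRing.Theory Num.Theory.
Import numFieldNormedType.Exports.

Local Open Scope classical_set_scope.
Local Open Scope ring_scope.

(** * Means over [0, 1] of polynomials and of powers of max(0, t + c) *)

Section unit_integral.
Variable R : realType.
Implicit Types (F f g : R -> R) (a b c x : R).

(** The kink at 0 needs no separate treatment: for all x and h, the numbers max(0, h + x)^2 and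
    max(0, x)^2 + 2 h max(0, x) differ by at most h^2, so the difference quotient is within |h| of
    its limit. *)
Lemma is_derive_sqr_pos x :
  is_derive x 1 (fun y : R => Num.max 0 y ^+ 2) (2 * Num.max 0 x).
Proof.
have cv : h^-1 *: (Num.max 0 (h *: (1 : R) + x) ^+ 2 - Num.max 0 x ^+ 2)
    @[h --> (0 : R)^'] --> 2 * Num.max 0 x.
  apply/cvgrPdist_le => e e0; near=> h.
  have h0 : h != 0 by near: h; exact: nbhs_dnbhs_neq.
  have he : `|h| <= e by near: h; exact: dnbhs0_le.
  apply: le_trans he.
  rewrite /GRing.scale /= mulr1 -[2 * _](mulKf h0) -mulrBr normrM normfV.
  rewrite ler_pdivrMl ?normr_gt0 // -expr2 real_normK ?num_real //.
  by rewrite ler_norml /Num.max; case: ltP => ?; case: ltP => ?; apply/andP; split; nra.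
exact: DeriveDef (cvgP _ cv) (cvg_lim _ cv).
Unshelve. all: by end_near.
Qed.

Lemma exprS_pos n x : Num.max 0 x ^+ n.+2 = x * Num.max 0 x ^+ n.+1.
Proof. by rewrite exprS /Num.max; case: ltP => // _; rewrite exprS !mul0r mulr0. Qed.

Lemma is_derive_pos n x : is_derive x 1
  (fun y : R => Num.max 0 y ^+ n.+2) (n.+2%:R * Num.max 0 x ^+ n.+1).
Proof.
elim: n => [|n IHn]; first exact: is_derive_sqr_pos.
(* The product rule then applies, and the exponent 1, for which differentiability at 0 fails, never
   occurs. *)
have -> : (fun y : R => Num.max 0 y ^+ n.+3) = id * (fun y : R => Num.max 0 y ^+ n.+2).
  by apply/funext => y; rewrite exprS_pos.
apply: is_derive_eq.
rewrite /GRing.scale /= mulr1 mulrCA -exprS_pos -[X in _ + X]mul1r.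
by rewrite -mulrDl natr1.
Qed.

(* [unit_mean f v]: the integral of f over [0, 1] is v, as witnessed by a primitive. *)
Definition unit_mean f v := exists F,
  [/\ forall x, is_derive x 1 F (f x), continuous f & F 1 - F 0 = v].

Lemma unit_mean_cst c : unit_mean (fun=> c) c.
Proof.
exists (fun x => c * x); split=> [x||]; last by rewrite mulr1 mulr0 subr0.
  by apply: is_derive_eq; rewrite /GRing.scale /= mulr1.
by move=> x; exact: cvg_cst.
Qed.

Lemma unit_meanD f g v w : unit_mean f v -> unit_mean g w ->
  unit_mean (fun x => f x + g x) (v + w).
Proof.
move=> [F [dF cf <-]] [G [dG cg <-]]; exists (fun x => F x + G x); split=> [x|x|].
- exact: is_deriveD.
- by apply: cvgD; [exact: cf|exact: cg].
- by rewrite opprD addrACA.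
Qed.

Lemma unit_meanZ c f v : unit_mean f v -> unit_mean (fun x => c * f x) (c * v).
Proof.
move=> [F [dF cf <-]]; exists (fun x => c * F x); split=> [x|x|].
- exact: is_deriveZ.
- by apply: cvgM; [exact: cvg_cst|exact: cf].
- by rewrite mulrBr.
Qed.

Lemma unit_meanX n : unit_mean (fun x => x ^+ n) n.+1%:R^-1.
Proof.
exists (fun x => n.+1%:R^-1 * x ^+ n.+1); split=> [x|x|].
- have := is_deriveZ n.+1%:R^-1 (is_deriveX n.+1 (is_derive_id x (1 : R))).
  by rewrite exprfctE => /is_derive_eq; apply; rewrite /GRing.scale /= mulr1 mulKf.
- exact: (@exprn_continuous R n x).
- by rewrite expr1n expr0n mulr1 mulr0 subr0.
Qed.

Lemma unit_mean_pos n c : unit_mean (fun x => Num.max 0 (x + c) ^+ n.+1)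
  ((Num.max 0 (1 + c) ^+ n.+2 - Num.max 0 c ^+ n.+2) / n.+2%:R).
Proof.
exists (fun x => n.+2%:R^-1 * Num.max 0 (x + c) ^+ n.+2); split=> [x|x|].
- have := @is_derive1_comp R _ (shift c) x _ _ (is_derive_pos n (x + c)) (is_derive_shift x 1 c).
  move=> /(is_deriveZ n.+2%:R^-1)/is_derive_eq; apply.
  by rewrite mulr1 /GRing.scale /= mulKf.
- apply: (@continuous_comp _ _ _ (fun x => Num.max 0 (x + c)) (fun y => y ^+ n.+1)).
    apply: continuous_max; first exact: cvg_cst.
    by apply: cvgD; [exact: cvg_id|exact: cvg_cst].
  exact: exprn_continuous.
- by rewrite add0r -mulrBr mulrC.
Qed.

(** The affine substitution is carried out on the primitive: [G] is a primitive of the rescaled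
    integrand, and the fundamental theorem of calculus applies to it. *)
Lemma integral_unit_mean f v a b : a < b -> unit_mean f v ->
  (\int[lebesgue_measure]_(x in `[a, b]) (f ((x - a) / (b - a)))%:E =
   ((b - a) * v)%:E)%E.
Proof.
move=> ab [F [dF cf <-]].
have ba0 : b - a != 0 by rewrite subr_eq0 gt_eqF.
pose G x := (b - a) * F ((x - a) / (b - a)).
have dG x : is_derive x 1 G (f ((x - a) / (b - a))).
  have dt : is_derive x 1 (fun y : R => (y - a) / (b - a)) (b - a)^-1.
    have := is_deriveZ (b - a)^-1 (is_derive_shift x (1 : R) (- a)).
    rewrite (_ : _ \*: _ = (fun y : R => (y - a) / (b - a))).
      by move=> /is_derive_eq; apply; rewrite /GRing.scale /= mulr1.
    by apply/funext => y; rewrite mulrC.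
  have := is_derive1_comp (dF _) dt.
  move=> /(is_deriveZ (b - a))/is_derive_eq; apply.
  by rewrite /GRing.scale /= mulrCA mulfV ?mulr1.
have cG : continuous G by move=> x; exact/differentiable_continuous/derivable1_diffP/ex_derive.
rewrite (@continuous_FTC2 _ _ G) //.
- rewrite /G subrr mul0r divff // -EFinB; congr EFin; ring.
- apply: continuous_subspaceT => x.
  apply: (@continuous_comp _ _ _ (fun x => (x - a) / (b - a)) f); last exact: cf.
  apply: cvgM; last exact: cvg_cst.
  by apply: cvgB; [exact: cvg_id|exact: cvg_cst].
- split=> [x _||]; first exact: ex_derive.
  + by apply: cvg_at_right_filter; exact: cG.
  + by apply: cvg_at_left_filter; exact: cG.
- move=> x _; by rewrite derive1E; exact: derive_val.
Qed.

(** Lets a mean be assembled from the combinators first, leaving two algebraic identities: one for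
    the integrand, one for the value. *)
Lemma unit_mean_eq f g v w : unit_mean g w -> f =1 g -> v = w -> unit_mean f v.
Proof. by move=> gw /funext -> ->. Qed.

(** Integrates min(x, c) = x - max(0, x - c). *)
Lemma unit_mean_min c : 0 <= c <= 1 ->
  unit_mean (fun x => Num.min x c) (c - c ^+ 2 / 2).
Proof.
move=> /andP[c0 c1].
apply: (unit_mean_eq (unit_meanD (unit_meanX 1) (unit_meanZ (-1) (unit_mean_pos 0 (- c))))).
  by move=> x; rewrite /Num.min /Num.max; case: ltP => ?; case: ltP => ?; lra.
rewrite (max_l (_ : - c <= 0)) ?(max_r (_ : 0 <= 1 - c)) ?subr_ge0 ?oppr_le0 //.
by field.
Qed.

(** Integrates min(x, c)^2 = x^2 - 2 c max(0, x - c) - max(0, x - c)^2. *)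
Lemma unit_mean_sqr_min c : 0 <= c <= 1 ->
  unit_mean (fun x => Num.min x c ^+ 2) (c ^+ 2 - 2 / 3 * c ^+ 3).
Proof.
move=> /andP[c0 c1].
apply: (unit_mean_eq (unit_meanD (unit_meanX 2) (unit_meanD
  (unit_meanZ (- 2 * c) (unit_mean_pos 0 (- c))) (unit_meanZ (-1) (unit_mean_pos 1 (- c)))))).
  by move=> x; rewrite /Num.min /Num.max; case: ltP => ?; case: ltP => ?; (ring || nra).
rewrite (max_l (_ : - c <= 0)) ?(max_r (_ : 0 <= 1 - c)) ?subr_ge0 ?oppr_le0 //.
by field.
Qed.

(* The height of the hull above the point with normalized coordinates t1, t2, t3;
   [gap1] and [gap2] are its successive means over t1 and t2. *)
Definition gap c12 c13 c23 c123 (t1 t2 t3 : R) :=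
  c12 * (Num.min t1 t2 - Num.max 0 (t1 + t2 - 1)) +
  c13 * (Num.min t1 t3 - Num.max 0 (t1 + t3 - 1)) +
  c23 * (Num.min t2 t3 + Num.max 0 (t1 + t2 - 1) + Num.max 0 (t1 + t3 - 1)
    - Num.max 0 (t1 + t2 + t3 - 1) - Num.max 0 (t1 + t2 + t3 - 2)) +
  c123 * (Num.min t1 (Num.min t2 t3) - Num.max 0 (t1 + t2 + t3 - 2)).

Definition gap1 c12 c13 c23 c123 (t2 t3 : R) :=
  c12 * (t2 - t2 ^+ 2) + c13 * (t3 - t3 ^+ 2) + c23 * (Num.min t2 t3 - t2 * t3) +
  c123 * (Num.min t2 t3 - Num.min t2 t3 ^+ 2 / 2 - Num.max 0 (t2 + t3 - 1) ^+ 2 / 2).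

Definition gap2 c12 c13 c23 c123 (t3 : R) :=
  c12 / 6 + (c13 + c23 / 2) * (t3 - t3 ^+ 2) + c123 * (t3 - t3 ^+ 2 + t3 ^+ 3 / 6).

(** For fixed t2 and t3, every term is a constant, a minimum of t1 with a constant in [0, 1], or a
    positive part of t1 plus a constant. *)
Lemma unit_mean_gap c12 c13 c23 c123 t2 t3 : 0 <= t2 <= 1 -> 0 <= t3 <= 1 ->
  unit_mean (fun t1 => gap c12 c13 c23 c123 t1 t2 t3) (gap1 c12 c13 c23 c123 t2 t3).
Proof.
move=> t2I t3I.
have mI : 0 <= Num.min t2 t3 <= 1.
  by case/andP: t2I => ? ?; case/andP: t3I => ? ?; rewrite /Num.min; case: ltP => ?; apply/andP.
have P2 := unit_mean_pos 0 (t2 - 1).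
have P3 := unit_mean_pos 0 (t3 - 1).
have S1 := unit_mean_pos 0 (t2 + t3 - 1).
have S2 := unit_mean_pos 0 (t2 + t3 - 2).
apply: (unit_mean_eq (unit_meanD (unit_meanD (unit_meanD
  (unit_meanZ c12 (unit_meanD (unit_mean_min t2I) (unit_meanZ (-1) P2)))
  (unit_meanZ c13 (unit_meanD (unit_mean_min t3I) (unit_meanZ (-1) P3))))
  (unit_meanZ c23 (unit_meanD (unit_meanD (unit_meanD (unit_meanD
     (unit_mean_cst (Num.min t2 t3)) P2) P3) (unit_meanZ (-1) S1)) (unit_meanZ (-1) S2))))
  (unit_meanZ c123 (unit_meanD (unit_mean_min mI) (unit_meanZ (-1) S2))))).
  by move=> t1; rewrite /gap !addrA; ring.
rewrite /gap1.
case/andP: t2I => ? ?; case/andP: t3I => ? ?.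
rewrite (max_l (_ : t2 - 1 <= 0)) ?subr_le0 // (max_l (_ : t3 - 1 <= 0)) ?subr_le0 //.
rewrite (max_l (_ : t2 + t3 - 2 <= 0)); last by lra.
rewrite (max_r (_ : 0 <= 1 + (t2 - 1))); last by lra.
rewrite (max_r (_ : 0 <= 1 + (t3 - 1))); last by lra.
rewrite (max_r (_ : 0 <= 1 + (t2 + t3 - 1))); last by lra.
(* The sign of t2 + t3 - 1 is not determined. Its positive part comes from the lower limit of [S1]
   and the upper limit of [S2]; the two cancel in the [c23] part, and that of [S2] survives in the
   [c123] part. *)
rewrite (_ : 1 + (t2 + t3 - 2) = t2 + t3 - 1); last by ring.
by field.
Qed.

Lemma unit_mean_gap1 c12 c13 c23 c123 t3 : 0 <= t3 <= 1 ->
  unit_mean (fun t2 => gap1 c12 c13 c23 c123 t2 t3) (gap2 c12 c13 c23 c123 t3).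
Proof.
move=> t3I; have min_t3 := unit_mean_min t3I.
apply: (unit_mean_eq (unit_meanD (unit_meanD (unit_meanD
  (unit_meanZ c12 (unit_meanD (unit_meanX 1) (unit_meanZ (-1) (unit_meanX 2))))
  (unit_mean_cst (c13 * (t3 - t3 ^+ 2))))
  (unit_meanZ c23 (unit_meanD min_t3 (unit_meanZ (- t3) (unit_meanX 1)))))
  (unit_meanZ c123 (unit_meanD (unit_meanD min_t3
     (unit_meanZ (- 2^-1) (unit_mean_sqr_min t3I)))
     (unit_meanZ (- 2^-1) (unit_mean_pos 1 (t3 - 1))))))).
  by move=> t2; rewrite /gap1 !addrA; field.
rewrite /gap2; case/andP: t3I => ? ?.
rewrite (max_l (_ : t3 - 1 <= 0)) ?subr_le0 //.
rewrite (max_r (_ : 0 <= 1 + (t3 - 1))); last by lra.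
by field.
Qed.

Lemma unit_mean_gap2 c12 c13 c23 c123 :
  unit_mean (gap2 c12 c13 c23 c123) ((c12 + c13) / 6 + c23 / 12 + 5 / 24 * c123).
Proof.
apply: (unit_mean_eq (unit_meanD (unit_meanD
  (unit_mean_cst (c12 / 6))
  (unit_meanZ (c13 + c23 / 2) (unit_meanD (unit_meanX 1) (unit_meanZ (-1) (unit_meanX 2)))))
  (unit_meanZ c123 (unit_meanD (unit_meanD (unit_meanX 1) (unit_meanZ (-1) (unit_meanX 2)))
    (unit_meanZ 6^-1 (unit_meanX 3)))))).
  by move=> t3; rewrite /gap2; field.
by field.
Qed.

End unit_integral.

(** * Product measures: sigma-finiteness and integration over slices *)

Section product_measure_sigma_finite.
Context d1 d2 (T1 : measurableType d1) (T2 : measurableType d2) (R : realType).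
Variables (m1 : {sigma_finite_measure set T1 -> \bar R})
  (m2 : {sigma_finite_measure set T2 -> \bar R}).

(* On [\x] itself, the canonical sigma-finite structure is only found for
   subprobabilities, whence this alias. *)
Definition sigma_finite_product : set (T1 * T2) -> \bar R := (m1 \x m2)%E.

HB.instance Definition _ := Measure.on sigma_finite_product.

Lemma sigma_finite_productT : sigma_finite setT sigma_finite_product.
Proof.
exact: isSigmaFinite.sigma_finiteT
  (lebesgue_integral_fubini.measure_function_Measure_isSigmaFinite__to__measure_function_isSigmaFinite
    m1 m2).
Qed.

HB.instance Definition _ :=
  Measure_isSigmaFinite.Build _ _ _ sigma_finite_product sigma_finite_productT.

End product_measure_sigma_finite.

Section slices.
Context d (T : measurableType d) (R : realType).
Variable m : {sigma_finite_measure set T -> \bar R}.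
Local Open Scope ereal_scope.

(** Here the last coordinate is the outer variable of integration, which is the order of [\x^]; the
    two product measures agree on rectangles, hence on all measurable sets by uniqueness. *)
Lemma product_measure_slices (A : set (T * measurableTypeR R)) (D : set R)
    (g : R -> \bar R) : measurable A ->
  (forall y, D y -> m (ysection A y) = g y) ->
  (forall y, ~ D y -> ysection A y = set0) ->
  (m \x @lebesgue_measure R) A = \int[lebesgue_measure]_(y in D) g y.
Proof.
move=> mA AD AnD.
transitivity ((m \x^ @lebesgue_measure R) A).
  by apply: product_measure_unique => //= B C mB mC; rewrite product_measure2E.
rewrite integral_mkcond; apply: eq_integral => y _ /=; rewrite patchE.
by case: ifPn => [/set_mem/AD//|/negP yD]; rewrite AnD ?measure0 // => Dy;
  apply: yD; exact: mem_set.
Qed.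

End slices.

(** * Volume of the region between two graphs over a box *)

Section volume_between_graphs.
Variables (R : realType) (a1 b1 a2 b2 a3 b3 : R) (lo up : R -> R -> R -> R).

Let mR := measurableTypeR R.
Let T := (mR * mR * mR * mR)%type.

Let box (q : T) := [/\ a1 <= q.1.1.2 <= b1, a2 <= q.1.2 <= b2 & a3 <= q.2 <= b3].

Let S : set T := [set q | box q /\
  lo q.1.1.2 q.1.2 q.2 <= q.1.1.1 <= up q.1.1.2 q.1.2 q.2].

Hypothesis mlo : measurable_fun setT (fun q : T => lo q.1.1.2 q.1.2 q.2).
Hypothesis mup : measurable_fun setT (fun q : T => up q.1.1.2 q.1.2 q.2).
Hypothesis lo_up : forall q, box q ->
  lo q.1.1.2 q.1.2 q.2 <= up q.1.1.2 q.1.2 q.2.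

Lemma measurable_between : measurable S.
Proof.
have m1 : measurable_fun [set: T] (fun q => q.1.1.2).
  by apply: measurableT_comp => //; apply: measurableT_comp.
have m0 : measurable_fun [set: T] (fun q => q.1.1.1).
  by apply: measurableT_comp => //; apply: measurableT_comp.
have m2 : measurable_fun [set: T] (fun q => q.1.2) by exact: measurableT_comp.
have m3 : measurable_fun [set: T] (fun q => q.2) by exact: measurable_snd.
have mle (f g : T -> R) : measurable_fun setT f -> measurable_fun setT g ->
    measurable [set q | f q <= g q].
  move=> mf mg; rewrite -[X in measurable X]setTI.
  have := measurable_fun_ler mf mg; rewrite /measurable_fun.
  by move=> /(_ measurableT [set true]); exact.
have mc (c : R) : measurable_fun [set: T] (fun=> c) by exact: measurable_cst.
rewrite (_ : S = [set q | a1 <= q.1.1.2] `&` [set q | q.1.1.2 <= b1] `&`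
    ([set q | a2 <= q.1.2] `&` [set q | q.1.2 <= b2]) `&`
    ([set q | a3 <= q.2] `&` [set q | q.2 <= b3]) `&`
    ([set q | lo q.1.1.2 q.1.2 q.2 <= q.1.1.1] `&`
     [set q | q.1.1.1 <= up q.1.1.2 q.1.2 q.2])).
  do 4?apply: measurableI; by [exact: mle (mc _) m1|exact: mle m1 (mc _)|
    exact: mle (mc _) m2|exact: mle m2 (mc _)|exact: mle (mc _) m3|
    exact: mle m3 (mc _)|exact: mle mlo m0|exact: mle m0 mup].
apply/seteqP; split=> q; rewrite /S /box /=.
  by move=> [[/andP[? ?] /andP[? ?] /andP[? ?]] /andP[? ?]]; split; [split; [split; split|split]|split].
by move=> [[[[-> ->] [-> ->]] [-> ->]] [-> ->]].
Qed.

Lemma Vol_between : (Vol R S =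
  \int[lebesgue_measure]_(x3 in `[a3, b3]) \int[lebesgue_measure]_(x2 in `[a2, b2])
    \int[lebesgue_measure]_(x1 in `[a1, b1]) (up x1 x2 x3 - lo x1 x2 x3)%:E)%E.
Proof.
(* The nested products of [Vol] are rebuilt so that each inner factor carries its sigma-finite
   structure. Then x3, x2 and x1 are sliced off in turn, leaving a segment in f. *)
pose l : {sigma_finite_measure set mR -> \bar R} := @lebesgue_measure R.
pose l2 := sigma_finite_product l l.
pose l3 := sigma_finite_product l2 l.
rewrite -[LHS]/((l3 \x @lebesgue_measure R)%E S).
apply: product_measure_slices.
- exact: measurable_between.
- move=> x3 x3I; rewrite -[LHS]/((l2 \x @lebesgue_measure R)%E (ysection S x3)).
  apply: product_measure_slices.
  + by apply: measurable_ysection; exact: measurable_between.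
  + move=> x2 x2I; rewrite -[LHS]/((l \x @lebesgue_measure R)%E (ysection (ysection S x3) x2)).
  apply: product_measure_slices.
    * by do 2!apply: measurable_ysection; exact: measurable_between.
    * move=> x1 x1I.
      rewrite (_ : ysection _ _ = `[lo x1 x2 x3, up x1 x2 x3]%classic).
        rewrite -[LHS]/(lebesgue_measure [set` `[lo x1 x2 x3, up x1 x2 x3]]).
        rewrite lebesgue_measure_itv /= lte_fin.
        (* The length formula returns 0 unless the endpoints are strictly ordered; in that case
           [lo_up] forces them to be equal, so their difference is 0 as well. The first coordinate 0
           below is arbitrary. *)
        case: ltP => // uplo; congr EFin.
        apply/eqP; rewrite eq_sym subr_eq0 eq_le uplo /=.
        exact: (@lo_up (0, x1, x2, x3)).
      apply/seteqP; split=> f; rewrite !ysectionE /= in_itv /=.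
        by move=> [].
      by move: x1I x2I x3I; rewrite /= !in_itv /= => ? ? ? loup; split.
    * move=> x1 x1I; apply/seteqP; split=> // f.
      by move: x1I; rewrite !ysectionE /= in_itv /= => xI -[[]].
  + move=> x2 x2I; apply/seteqP; split=> // f.
    by move: x2I; rewrite !ysectionE /= in_itv /= => xI -[[]].
- move=> x3 x3I; apply/seteqP; split=> // f.
  by move: x3I; rewrite !ysectionE /= in_itv /= => xI -[[]].
Qed.

End volume_between_graphs.

(** * Finite convex combinations in a convex set *)

Section convex_combination.
Variables (R : realType) (M : lmodType R) (A : set M).
Hypothesis cA : @convex_set R M A.

Lemma convex_set_mix (t : R) (x y : M) :
  0 <= t <= 1 -> A x -> A y -> A (t *: x + (1 - t) *: y).
Proof.
move=> t01 Ax Ay.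
have t01' : Itv.spec (@Itv.num_sem R) (Itv.Real `[0%Z, 1%Z]) t.
  rewrite /= /Itv.num_sem /= in_itv /=; case/andP: t01 => h1 h2.
  by rewrite ger0_real //= h1 h2.
have := @cA x y (Itv.Def t01').
rewrite !inE; exact.
Qed.

(** The pair of [c] and [y] is an accumulator: each step of the induction replaces [y] and the head
    of the list by their barycentre, with weight c + w, so that the total weight stays 1. *)
Lemma convex_set_sum (s : seq (R * M)) (c : R) (y : M) :
  0 <= c -> A y -> (forall i, (i < size s)%N ->
    0 <= (nth (0, y) s i).1 /\ A (nth (0, y) s i).2) ->
  c + \sum_(p <- s) p.1 = 1 -> A (c *: y + \sum_(p <- s) p.1 *: p.2).
Proof.
elim: s c y => [|[w x] s IH] c y c0 Ay As.
  by rewrite !big_nil !addr0 => ->; rewrite scale1r.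
rewrite !big_cons /= !addrA => cws.
have [/= w0 Ax] := As 0%N isT.
have {}As i z : (i < size s)%N -> 0 <= (nth (0, z) s i).1 /\ A (nth (0, z) s i).2.
  by move=> si; rewrite (set_nth_default (0, y)) //; exact: (As i.+1).
(* If both weights vanish there is no barycentre to form, and [y] is carried on with weight 0. *)
have [cw0|cw0] := eqVneq (c + w) 0.
  have /andP[/eqP c0' /eqP w0'] : (c == 0) && (w == 0) by rewrite -paddr_eq0 ?cw0.
  rewrite c0' w0' !scale0r addr0 -[X in A (X + _)](scale0r y); apply: IH => //.
    by move=> i; apply: As.
  by rewrite -[LHS]/(0 + _) -{1}cw0.
have cw : 0 < c + w by rewrite lt_def cw0 addr_ge0.
pose u := c / (c + w).
have u01 : 0 <= u <= 1.
  by rewrite divr_ge0 ?(ltW cw) //= ler_pdivrMr // mul1r lerDl.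
have -> : c *: y + w *: x = (c + w) *: (u *: y + (1 - u) *: x).
  by rewrite scalerDr !scalerA mulrBr mulr1 /u mulrCA mulfV // mulr1 [c + w]addrC addrK.
apply: IH; [exact: ltW|exact: convex_set_mix| |exact: cws].
by move=> i; apply: As.
Qed.

End convex_combination.

(** * The trilinear hull as a region between two graphs, and its volume *)

Section trilinear_hull.
Variables (R : realType) (a1 b1 a2 b2 a3 b3 : R).
Hypotheses (h1 : 0 <= a1 < b1) (h2 : 0 <= a2 < b2) (h3 : 0 <= a3 < b3).
Hypothesis h12 : a1 * b2 * b3 + b1 * a2 * a3 <= b1 * a2 * b3 + a1 * b2 * a3.
Hypothesis h23 : b1 * a2 * b3 + a1 * b2 * a3 <= b1 * b2 * a3 + a1 * a2 * b3.

Let d1 := b1 - a1.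
Let d2 := b2 - a2.
Let d3 := b3 - a3.
Let c12 := d1 * d2 * a3.
Let c13 := d1 * a2 * d3.
Let c23 := a1 * d2 * d3.
Let c123 := d1 * d2 * d3.

Let a1_ge0 : 0 <= a1. Proof. by case/andP: h1. Qed.
Let a2_ge0 : 0 <= a2. Proof. by case/andP: h2. Qed.
Let a3_ge0 : 0 <= a3. Proof. by case/andP: h3. Qed.
Let d1_gt0 : 0 < d1. Proof. by rewrite subr_gt0; case/andP: h1. Qed.
Let d2_gt0 : 0 < d2. Proof. by rewrite subr_gt0; case/andP: h2. Qed.
Let d3_gt0 : 0 < d3. Proof. by rewrite subr_gt0; case/andP: h3. Qed.

Let c23_ge0 : 0 <= c23.
Proof. by rewrite !mulr_ge0 // ltW. Qed.

Let c23_le_c13 : c23 <= c13.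
Proof.
rewrite -subr_ge0 (_ : c13 - c23 = b1 * a2 * b3 + a1 * b2 * a3
  - (a1 * b2 * b3 + b1 * a2 * a3)) ?subr_ge0 //.
by rewrite /c13 /c23 /d1 /d2 /d3; ring.
Qed.

Let c13_le_c12 : c13 <= c12.
Proof.
rewrite -subr_ge0 (_ : c12 - c13 = b1 * b2 * a3 + a1 * a2 * b3
  - (b1 * a2 * b3 + a1 * b2 * a3)) ?subr_ge0 //.
by rewrite /c12 /c13 /d1 /d2 /d3; ring.
Qed.

Let c123_ge0 : 0 <= c123.
Proof. by rewrite !mulr_ge0 // ltW. Qed.

(** The expansion of the product of the a_i + d_i t_i, with each monomial t_i t_j replaced by p_ij
    and t1 t2 t3 by p_123. *)
Let interp (t1 t2 t3 p12 p13 p23 p123 : R) : R :=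
  a1 * a2 * a3 + d1 * a2 * a3 * t1 + a1 * d2 * a3 * t2 + a1 * a2 * d3 * t3 +
  c12 * p12 + c13 * p13 + c23 * p23 + c123 * p123.

(* w_123, w_12, w_13, w_23, w_1, w_2, w_3 and the weight of the empty set. *)
Let weights (t1 t2 t3 p12 p13 p23 p123 : R) : seq R :=
  [:: p123; p12 - p123; p13 - p123; p23 - p123;
      t1 - p12 - p13 + p123; t2 - p12 - p23 + p123; t3 - p13 - p23 + p123;
      1 - t1 - t2 - t3 + p12 + p13 + p23 - p123].

Let H := trilinear_hull a1 b1 a2 b2 a3 b3.

Let convex_H : @convex_set R (R4 R) H.
Proof.
move=> x y l; rewrite !inE => Hx Hy S [cS VS].
by apply/set_mem/cS; apply/mem_set; [exact: Hx|exact: Hy].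
Qed.

Lemma hull_of_weights t1 t2 t3 p12 p13 p23 p123 :
  all (>= 0) (weights t1 t2 t3 p12 p13 p23 p123) ->
  H (interp t1 t2 t3 p12 p13 p23 p123, a1 + d1 * t1, a2 + d2 * t2, a3 + d3 * t3).
Proof.
move=> w0.
have vH x1 x2 x3 : [set a1; b1] x1 -> [set a2; b2] x2 -> [set a3; b3] x3 ->
    H (x1 * x2 * x3, x1, x2, x3).
  by move=> X1 X2 X3 S [_]; apply; exists x1, x2, x3.
(* Same order as in [weights]: the vertex of S has x_i = b_i exactly when i is in S. *)
pose v : seq (R4 R) := [:: (b1 * b2 * b3, b1, b2, b3);
  (b1 * b2 * a3, b1, b2, a3); (b1 * a2 * b3, b1, a2, b3);
  (a1 * b2 * b3, a1, b2, b3); (b1 * a2 * a3, b1, a2, a3);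
  (a1 * b2 * a3, a1, b2, a3); (a1 * a2 * b3, a1, a2, b3);
  (a1 * a2 * a3, a1, a2, a3)].
pose s := zip (weights t1 t2 t3 p12 p13 p23 p123) v.
(* The accumulator starts at some vertex with weight 0, so it contributes nothing to the sum. *)
have A := @convex_set_sum R _ _ convex_H s 0 (a1 * a2 * a3, a1, a2, a3).
rewrite [X in H X](_ : _ = 0 *: ((a1 * a2 * a3, a1, a2, a3) : R4 R)
    + \sum_(p <- s) p.1 *: p.2).
  apply: A => //.
  - by apply: vH; left.
  - move: w0 => /and4P[w1 w2 w3 /and4P[w4 w5 w6 /and3P[w7 w8 _]]].
    case => [|[|[|[|[|[|[|[|[]]]]]]]]] //= _; split=> //;
    by apply: vH; do [by left | by right].
  - by rewrite /s /= !big_cons big_nil /=; ring.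
rewrite scale0r add0r /s /= !big_cons big_nil /= addr0.
by congr (_, _, _, _);
  rewrite /= /GRing.scale /= /interp /c12 /c13 /c23 /c123 /d1 /d2 /d3; ring.
Qed.

(** By minimality of the hull: [K] is convex because the weights and the point are affine in the
    seven parameters, and [K] contains the vertices. *)
Lemma weights_of_hull q : H q -> exists t1 t2 t3 p12 p13 p23 p123,
  all (>= 0) (weights t1 t2 t3 p12 p13 p23 p123) /\
  q = (interp t1 t2 t3 p12 p13 p23 p123, a1 + d1 * t1, a2 + d2 * t2, a3 + d3 * t3).
Proof.
pose K : set (R4 R) := [set q | exists t1 t2 t3 p12 p13 p23 p123,
  all (>= 0) (weights t1 t2 t3 p12 p13 p23 p123) /\
  q = (interp t1 t2 t3 p12 p13 p23 p123, a1 + d1 * t1, a2 + d2 * t2, a3 + d3 * t3)].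
move=> Hq; apply: (Hq K); split=> [x y l|].
  rewrite !inE => -[t1 [t2 [t3 [p12 [p13 [p23 [p123 [w ->]]]]]]]].
  move=> -[u1 [u2 [u3 [q12 [q13 [q23 [q123 [v ->]]]]]]]].
  pose m x y := l%:num * x + (1 - l%:num) * y.
  exists (m t1 u1), (m t2 u2), (m t3 u3),
    (m p12 q12), (m p13 q13), (m p23 q23), (m p123 q123).
  split; last first.
    rewrite /conv /=.
    by congr (_, _, _, _); rewrite /= /GRing.scale /= /interp /m /unstable.onem; ring.
  have m0 a b : 0 <= a -> 0 <= b -> 0 <= m a b.
    by move=> a0 b0; rewrite addr_ge0 // mulr_ge0 // subr_ge0.
  move: w => /and4P[w1 w2 w3 /and4P[w4 w5 w6 /and3P[w7 w8 _]]].
  move: v => /and4P[v1 v2 v3 /and4P[v4 v5 v6 /and3P[v7 v8 _]]].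
  have -> : weights (m t1 u1) (m t2 u2) (m t3 u3)
        (m p12 q12) (m p13 q13) (m p23 q23) (m p123 q123) =
      [seq m p.1 p.2 | p <- zip (weights t1 t2 t3 p12 p13 p23 p123)
                                (weights u1 u2 u3 q12 q13 q23 q123)].
    rewrite /weights /=; congr [:: _; _; _; _; _; _; _; _]; rewrite /m; ring.
  by rewrite /= !m0.
move=> _ [x1 [x2 [x3 [X1 X2 X3 ->]]]].
have tE (a b x : R) : a < b -> [set a; b] x ->
    exists2 t : R, (t = 0) \/ (t = 1) & x = a + (b - a) * t.
  move=> ab [->|->]; first by exists 0; [left|rewrite mulr0 addr0].
  by exists 1; [right|rewrite mulr1 subrKC].
have [t1 T1 ->] := tE _ _ _ (proj2 (andP h1)) X1.
have [t2 T2 ->] := tE _ _ _ (proj2 (andP h2)) X2.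
have [t3 T3 ->] := tE _ _ _ (proj2 (andP h3)) X3.
(* At a vertex the p are true products of numbers in {0, 1}, so one weight is 1 and the others are
   0. *)
exists t1, t2, t3, (t1 * t2), (t1 * t3), (t2 * t3), (t1 * t2 * t3); split.
  case: T1 => ->; case: T2 => ->; case: T3 => -> /=;
    by do ?[apply/andP; split] => //; lra.
by congr (_, _, _, _); rewrite /interp /c12 /c13 /c23 /c123 /d1 /d2 /d3; ring.
Qed.

Let upper (t1 t2 t3 : R) : R := interp t1 t2 t3
  (Num.min t1 t2) (Num.min t1 t3) (Num.min t2 t3) (Num.min t1 (Num.min t2 t3)).

(* The choice of p23 makes p12 + p13 + p23 equal to the least
   convex function of t1 + t2 + t3 that takes the value 'C(k, 2) at k = 0, ..., 3. *)
Let lower (t1 t2 t3 : R) : R :=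
  let p12 := Num.max 0 (t1 + t2 - 1) in
  let p13 := Num.max 0 (t1 + t3 - 1) in
  let p123 := Num.max 0 (t1 + t2 + t3 - 2) in
  interp t1 t2 t3 p12 p13
    (Num.max 0 (t1 + t2 + t3 - 1) + p123 - p12 - p13) p123.

Lemma upper_weights t1 t2 t3 : 0 <= t1 <= 1 -> 0 <= t2 <= 1 -> 0 <= t3 <= 1 ->
  all (>= 0) (weights t1 t2 t3 (Num.min t1 t2) (Num.min t1 t3) (Num.min t2 t3)
    (Num.min t1 (Num.min t2 t3))).
Proof.
move=> /andP[? ?] /andP[? ?] /andP[? ?]; rewrite /= /Num.min.
by case: (ltP t2 t3) => ?; case: (ltP t1 t2) => ?; case: (ltP t1 t3) => ?;
  do ?[apply/andP; split] => //; lra.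
Qed.

Lemma lower_weights t1 t2 t3 : 0 <= t1 <= 1 -> 0 <= t2 <= 1 -> 0 <= t3 <= 1 ->
  let p12 := Num.max 0 (t1 + t2 - 1) in
  let p13 := Num.max 0 (t1 + t3 - 1) in
  let p123 := Num.max 0 (t1 + t2 + t3 - 2) in
  all (>= 0) (weights t1 t2 t3 p12 p13
    (Num.max 0 (t1 + t2 + t3 - 1) + p123 - p12 - p13) p123).
Proof.
move=> /andP[? ?] /andP[? ?] /andP[? ?]; rewrite /= /Num.max.
by do 4![case: ltP => ?]; do ?[apply/andP; split] => //; lra.
Qed.

Lemma hull_upper t1 t2 t3 : 0 <= t1 <= 1 -> 0 <= t2 <= 1 -> 0 <= t3 <= 1 ->
  H (upper t1 t2 t3, a1 + d1 * t1, a2 + d2 * t2, a3 + d3 * t3).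
Proof. by move=> t1I t2I t3I; apply: hull_of_weights; exact: upper_weights. Qed.

Lemma hull_lower t1 t2 t3 : 0 <= t1 <= 1 -> 0 <= t2 <= 1 -> 0 <= t3 <= 1 ->
  H (lower t1 t2 t3, a1 + d1 * t1, a2 + d2 * t2, a3 + d3 * t3).
Proof. by move=> t1I t2I t3I; apply: hull_of_weights; exact: lower_weights. Qed.

(** The lower bound rests on c12 p12 + c13 p13 + c23 p23 = (c12 - c23) p12 + (c13 - c23) p13 + c23
    (p12 + p13 + p23), whose coefficients are nonnegative. The upper bound is termwise. *)
Lemma interp_between t1 t2 t3 p12 p13 p23 p123 :
  all (>= 0) (weights t1 t2 t3 p12 p13 p23 p123) ->
  lower t1 t2 t3 <= interp t1 t2 t3 p12 p13 p23 p123 <= upper t1 t2 t3.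
Proof.
move=> /and4P[w1 w2 w3 /and4P[w4 w5 w6 /and3P[w7 w8 _]]].
apply/andP; split.
  rewrite /lower /interp /=.
  set m12 := Num.max 0 (t1 + t2 - 1).
  set m13 := Num.max 0 (t1 + t3 - 1).
  set m := Num.max 0 (t1 + t2 + t3 - 1).
  set m123 := Num.max 0 (t1 + t2 + t3 - 2).
  have e12 : 0 <= (c12 - c23) * (p12 - m12).
    rewrite mulr_ge0 // subr_ge0 ?(le_trans c23_le_c13) //.
    by rewrite ge_max; apply/andP; split; lra.
  have e13 : 0 <= (c13 - c23) * (p13 - m13).
    rewrite mulr_ge0 // subr_ge0 //.
    by rewrite ge_max; apply/andP; split; lra.
  (* Let N be the size of a random subset drawn with the given weights, and s = t1 + t2 + t3 its
     mean. Then 'C(N, 2) has mean p12 + p13 + p23 and is at least 0, N - 1 and 2 N - 3; the largest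
     of 0, s - 1 and 2 s - 3 is [m] + [m123]. *)
  have e23 : 0 <= c23 * (p12 + p13 + p23 - m - m123).
    by rewrite mulr_ge0 // /m /m123 /Num.max; do 2![case: ltP => ?]; lra.
  have e123 : 0 <= c123 * (p123 - m123).
    by rewrite mulr_ge0 // subr_ge0 ge_max; apply/andP; split; lra.
  by lra.
rewrite /upper /interp /=; repeat apply: lerD => //;
  rewrite ler_wpM2l // ?(le_trans c23_ge0, le_trans c23_le_c13) // !le_min;
  by do ?[apply/andP; split]; lra.
Qed.

Lemma lower_le_upper t1 t2 t3 : 0 <= t1 <= 1 -> 0 <= t2 <= 1 -> 0 <= t3 <= 1 ->
  lower t1 t2 t3 <= upper t1 t2 t3.
Proof.
move=> t1I t2I t3I.
by have /andP[] := interp_between (upper_weights t1I t2I t3I).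
Qed.

(** For the converse inclusion, both ends of each vertical segment lie in the hull, hence so does
    the segment. *)
Lemma trilinear_hullE : H = [set q : R4 R | exists f t1 t2 t3 : R,
  [/\ 0 <= t1 <= 1, 0 <= t2 <= 1, 0 <= t3 <= 1,
      lower t1 t2 t3 <= f <= upper t1 t2 t3 &
      q = (f, a1 + d1 * t1, a2 + d2 * t2, a3 + d3 * t3)]].
Proof.
apply/seteqP; split=> q.
  move=> /weights_of_hull[t1 [t2 [t3 [p12 [p13 [p23 [p123 [w ->]]]]]]]].
  exists (interp t1 t2 t3 p12 p13 p23 p123), t1, t2, t3.
  split; [ | | |exact: interp_between|by []];
    move: w => /and4P[w1 w2 w3 /and4P[w4 w5 w6 /and3P[w7 w8 _]]];
    by apply/andP; split; lra.
move=> [f [t1 [t2 [t3 [t1I t2I t3I /andP[lq qu] ->]]]]].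
(* The mixing weight [l] divides by the height, which vanishes at the vertices of the box for
   instance. *)
have [ul|ul] := eqVneq (upper t1 t2 t3) (lower t1 t2 t3).
  have -> : f = upper t1 t2 t3 by apply/eqP; rewrite eq_le qu ul.
  exact: hull_upper.
have ul0 : 0 < upper t1 t2 t3 - lower t1 t2 t3.
  by rewrite subr_gt0 lt_neqAle eq_sym ul (le_trans lq).
pose l : R := (f - lower t1 t2 t3) / (upper t1 t2 t3 - lower t1 t2 t3).
have l01 : 0 <= l <= 1.
  rewrite divr_ge0 ?subr_ge0 ?(le_trans lq) //=.
  by rewrite ler_pdivrMr // mul1r lerD2r.
rewrite [X in H X](_ : _ =
    l *: ((upper t1 t2 t3, a1 + d1 * t1, a2 + d2 * t2, a3 + d3 * t3) : R4 R) +
    (1 - l) *: ((lower t1 t2 t3, a1 + d1 * t1, a2 + d2 * t2, a3 + d3 * t3) : R4 R)).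
  by apply: (@convex_set_mix _ _ _ convex_H) => //; [exact: hull_upper|exact: hull_lower].
have -> : f = lower t1 t2 t3 + l * (upper t1 t2 t3 - lower t1 t2 t3).
  by rewrite /l divfK ?lt0r_neq0 // subrKC.
by congr (_, _, _, _); rewrite /= /GRing.scale /=; ring.
Qed.

Lemma upper_sub_lower t1 t2 t3 :
  upper t1 t2 t3 - lower t1 t2 t3 = gap c12 c13 c23 c123 t1 t2 t3.
Proof. by rewrite /upper /lower /interp /gap; ring. Qed.

Let unit_coordinate (a b x : R) : R := (x - a) / (b - a).

Lemma unit_coordinateE a b x : a < b ->
  (0 <= unit_coordinate a b x <= 1) = (a <= x <= b).
Proof.
move=> ab; rewrite /unit_coordinate.
by rewrite ler_pdivlMr ?subr_gt0 // mul0r subr_ge0 ler_pdivrMr ?subr_gt0 // mul1r lerD2r.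
Qed.

Let u1 := unit_coordinate a1 b1.
Let u2 := unit_coordinate a2 b2.
Let u3 := unit_coordinate a3 b3.

Let mR := measurableTypeR R.

(** Eliminates the parameters t_i by inverting t = (x - a) / (b - a), which gives the form required
    by [Vol_between]. *)
Lemma hull_between : H = [set q : R4 R |
  [/\ a1 <= q.1.1.2 <= b1, a2 <= q.1.2 <= b2 & a3 <= q.2 <= b3] /\
  lower (u1 q.1.1.2) (u2 q.1.2) (u3 q.2) <= q.1.1.1 <=
  upper (u1 q.1.1.2) (u2 q.1.2) (u3 q.2)].
Proof.
have uK a b t : a < b -> unit_coordinate a b (a + (b - a) * t) = t.
  by move=> ab; rewrite /unit_coordinate addrAC subrr add0r mulrC mulKf // subr_eq0 gt_eqF.
have Ku a b x : a < b -> a + (b - a) * unit_coordinate a b x = x.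
  by move=> ab; rewrite /unit_coordinate mulrC divfK ?subr_eq0 ?gt_eqF // subrKC.
have [_ ab1] := andP h1; have [_ ab2] := andP h2; have [_ ab3] := andP h3.
rewrite trilinear_hullE; apply/seteqP; split=> q /=.
  move=> [f [t1 [t2 [t3 [t1I t2I t3I lfu ->]]]]] /=.
  rewrite -(unit_coordinateE _ ab1) -(unit_coordinateE _ ab2) -(unit_coordinateE _ ab3).
  by rewrite /u1 /u2 /u3 !uK.
move: q => [[[f x1] x2] x3] /= [[x1I x2I x3I] lfu].
exists f, (u1 x1), (u2 x2), (u3 x3).
by rewrite !unit_coordinateE // !Ku.
Qed.

(** The height is [gap] in normalized coordinates; integrating over x1, x2, x3 in turn takes a mean
    each time and brings out the side lengths [d1], [d2], [d3]. *)
Lemma Vol_trilinear_hull :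
  Vol R H = (d1 * d2 * d3 * ((c12 + c13) / 6 + c23 / 12 + 5 / 24 * c123))%:E.
Proof.
have [_ ab1] := andP h1; have [_ ab2] := andP h2; have [_ ab3] := andP h3.
have mu (a b : R) (x : mR * mR * mR * mR -> R) : measurable_fun setT x ->
    measurable_fun setT (fun q => unit_coordinate a b (x q)).
  move=> mx; apply: measurable_funM; last exact: measurable_cst.
  by apply: measurable_funB => //; exact: measurable_cst.
have m1 : measurable_fun [set: mR * mR * mR * mR] (fun q => u1 q.1.1.2).
  by apply: mu; apply: measurableT_comp => //; apply: measurableT_comp.
have m2 : measurable_fun [set: mR * mR * mR * mR] (fun q => u2 q.1.2).
  by apply: mu; exact: measurableT_comp.
have m3 : measurable_fun [set: mR * mR * mR * mR] (fun q => u3 q.2).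
  by apply: mu; exact: measurable_snd.
rewrite hull_between.
rewrite (@Vol_between R a1 b1 a2 b2 a3 b3
  (fun x1 x2 x3 => lower (u1 x1) (u2 x2) (u3 x3))
  (fun x1 x2 x3 => upper (u1 x1) (u2 x2) (u3 x3))).
- transitivity (\int[lebesgue_measure]_(x3 in `[a3, b3])
      (d2 * (d1 * gap2 c12 c13 c23 c123 (u3 x3)))%:E)%E.
    apply: eq_integral => x3 /set_mem /=; rewrite in_itv /= -(unit_coordinateE _ ab3) => u3I.
    transitivity (\int[lebesgue_measure]_(x2 in `[a2, b2])
        (d1 * gap1 c12 c13 c23 c123 (u2 x2) (u3 x3))%:E)%E.
      apply: eq_integral => x2 /set_mem /=; rewrite in_itv /= -(unit_coordinateE _ ab2) => u2I.
      rewrite -(integral_unit_mean ab1 (unit_mean_gap c12 c13 c23 c123 u2I u3I)).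
      by apply: eq_integral => x1 _; rewrite upper_sub_lower.
    exact: (integral_unit_mean ab2 (unit_meanZ d1 (unit_mean_gap1 c12 c13 c23 c123 u3I))).
  rewrite (integral_unit_mean ab3 (unit_meanZ d2 (unit_meanZ d1 (unit_mean_gap2 c12 c13 c23 c123)))).
  by congr EFin; rewrite -/d3; ring.
- rewrite /lower /interp /=.
  by repeat first [exact: m1 | exact: m2 | exact: m3 | exact: measurable_cst
    | apply: measurable_funB | apply: measurable_funD | apply: measurable_funM
    | apply: measurable_maxr].
- rewrite /upper /interp /=.
  by repeat first [exact: m1 | exact: m2 | exact: m3 | exact: measurable_cst
    | apply: measurable_funB | apply: measurable_funD | apply: measurable_funM
    | apply: measurable_minr].
- by move=> q [x1I x2I x3I]; apply: lower_le_upper; rewrite unit_coordinateE.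
Qed.

End trilinear_hull.

Theorem theorem4p1 (R : realType) (a1 b1 a2 b2 a3 b3 : R)
  (h1 : 0 <= a1 < b1) (h2 : 0 <= a2 < b2) (h3 : 0 <= a3 < b3)
  (h12 : a1 * b2 * b3 + b1 * a2 * a3 <= b1 * a2 * b3 + a1 * b2 * a3)
  (h23 : b1 * a2 * b3 + a1 * b2 * a3 <= b1 * b2 * a3 + a1 * a2 * b3) :
  Vol R (trilinear_hull a1 b1 a2 b2 a3 b3) =
  ((b1 - a1) * (b2 - a2) * (b3 - a3) *
   (b1 * (5 * b2 * b3 - a2 * b3 - b2 * a3 - 3 * a2 * a3) +
    a1 * (5 * a2 * a3 - b2 * a3 - a2 * b3 - 3 * b2 * b3)) / 24)%:E.
Proof.
rewrite (Vol_trilinear_hull h1 h2 h3 h12 h23); congr EFin.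
by field.
Qed.
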